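(* For every fixed $c\ge1$ there exist constants $C_0,C_1,c_0,n_0>0$ such that the following holds for every fixed $0<\beta<1/2$. Consider any sequence of parameters $(n,L,R,\varepsilon,T)$ (sequence index suppressed) with $n\to\infty$, $n\ge n_0$, $L,R>0$, $$0<\varepsilon<c_0\frac{LR^2}{\sqrt n},\qquad T=o\left[\left(\frac{n^{3/4}R\sqrt L}{\sqrt\varepsilon}\right)^c\right].$$ Then, for all sufficiently late members of the sequence, $$\Delta_{\mathcal F_{\rm Sm}^L(B_R)}(\varepsilon,\beta,T)\le C_0\max\left\{\frac{\varepsilon^{3/2}}{n^{1/4}\sqrt L\,R},\frac{\varepsilon}{n}\right\}\left(13C_1c\log\frac{C_1n^{3/4}R\sqrt L}{\sqrt\varepsilon}\right)^2.$$
   Context: $B_R=\{x\in\mathbb R^n:\|x\|_2\le R\}$. $\mathcal F_{\rm Sm}^L(B_R)$ is the class of convex functions $f:B_R\to\mathbb R$ that are $L$-smooth on $B_R$, meaning that $f$ is continuously differentiable on a neighbourhood of $B_R$ and $\nabla f$ is $L$-Lipschitz on $B_R$ (Euclidean norm). Noisy oracle: for $f:S\to\mathbb R$, $S\subset\mathbb R^n$, $\delta\ge0$, let $\mathsf O_\delta(f)=\{O:S\to\mathbb R:\ \sup_{x\in S}|O(x)-f(x)|\le\delta\}$. Solvability: algorithms query points of $S$ and output a point of $S$. A randomized adaptive algorithm $A$ making at most $T$ oracle calls $(\varepsilon,\beta,\delta,T)$-solves a class $\mathcal F$ of functions on $S$ if for every $f\in\mathcal F$ and every deterministic oracle $O\in\mathsf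 O_\delta(f)$ its output $A^O$ satisfies $\mathbb P_A\{f(A^O)-\inf_S f\le\varepsilon\}\ge1-\beta$, the probability being over the internal randomness of $A$ (deterministic adaptive algorithms are included). The maximum admissible level of noise is $\Delta_{\mathcal F}(\varepsilon,\beta,T)=\sup\{\delta:\ \text{there is }A\text{ that }(\varepsilon,\beta,\delta,T)\text{-solves }\mathcal F\}$. Convention: $T=o(Q)$ means $T/Q\to0$ along the sequence of parameters. All constants are independent of the particular sequence. *)

(* Defs.v *)
From mathcomp Require Import all_boot all_order all_algebra.
From mathcomp Require Import all_classical all_reals all_analysis.

Set Implicit Arguments.
Unset Strict Implicit.
Unset Printing Implicit Defensive.

Import Order.TTheory GRing.Theory Num.Theory.
Import numFieldNormedType.Exports.

Local Open Scope classical_set_scope.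
Local Open Scope ring_scope.

(* The library norm `|x| on 'rV[R]_n is the sup norm; it induces the same
   topology (and the same notion of differentiability) as this one. *)
Definition enorm (R : realType) (n : nat) (x : 'rV[R]_n) : R :=
  Num.sqrt (\sum_(i < n) x 0 i ^+ 2).

Definition eball (R : realType) (n : nat) (r : R) : set 'rV[R]_n :=
  [set x | enorm x <= r].
Arguments eball {R} n r.

Definition gradient (R : realType) (n : nat) (g : 'rV[R]_n -> R)
  (x : 'rV[R]_n) : 'rV[R]_n :=
  \row_(i < n) 'D_(delta_mx 0 i) g x.

Definition C1_on (R : realType) (n : nat) (U : set 'rV[R]_n)
  (g : 'rV[R]_n -> R) : Prop :=
  (forall x, U x -> differentiable g x) /\
  (forall x, U x -> {for x, continuous (gradient g)}).

(* Convex L-smooth functions on the closed Euclidean ball of radius r.  A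
   function on the ball is a function on the subtype; g is the extension of f
   to a neighbourhood U of the ball (extended arbitrarily outside U) that gives
   a meaning to the gradient at boundary points. *)
Definition smooth_convex (R : realType) (n : nat) (L r : R) :
  set (eball n r -> R) :=
  [set f | exists (U : set 'rV[R]_n) (g : 'rV[R]_n -> R),
    [/\ open U /\ eball n r `<=` U,
        forall x : eball n r, f x = g (\val x),
        convex_function (eball n r) g,
        C1_on U g &
        forall x y, eball n r x -> eball n r y ->
          enorm (gradient g x - gradient g y) <= L * enorm (x - y)]].
Arguments smooth_convex {R} n L r.

Definition noisy_oracle (R : realType) (S : Type) (delta : R) (f : S -> R) :
  set (S -> R) :=
  [set O | (ereal_sup (range (fun x => `|O x - f x|%:E)) <= delta%:E)%E].

(* Deterministic adaptive algorithms making at most T oracle calls, as decision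
   trees: either stop and output a point, or query a point and continue
   according to the real number answered. *)
Inductive algorithm (R S : Type) : nat -> Type :=
| Output (T : nat) of S : algorithm R S T
| Query (T : nat) of S & (R -> algorithm R S T) : algorithm R S T.+1.

Fixpoint run (R S : Type) (T : nat) (O : S -> R) (a : algorithm R S T) : S :=
  match a with
  | Output _ x => x
  | Query _ x k => run O (k (O x))
  end.

(* A randomized algorithm is a deterministic algorithm A w depending on the
   internal randomness w, drawn from a probability space.  Neither A nor the
   oracle is assumed measurable, so "with probability at least 1 - beta" means
   that the success event contains a measurable event of that probability; this
   is the plain inequality whenever the success event is itself measurable. *)
Definition solves (R : realType) (S : Type) (F : set (S -> R))
  (eps beta delta : R) (T : nat) (d : measure_display) (W : measurableType d)
  (P : probability W R) (A : W -> algorithm R S T) : Prop :=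
  forall f, F f -> forall O, noisy_oracle delta f O ->
    exists E : set W,
      [/\ measurable E,
          E `<=` [set w | ((f (run O (A w)))%:E
                           - ereal_inf (range (EFin \o f)) <= eps%:E)%E] &
          ((1 - beta)%:E <= P E)%E].

Definition solvable (R : realType) (S : Type) (F : set (S -> R))
  (eps beta delta : R) (T : nat) : Prop :=
  exists (d : measure_display) (W : measurableType d) (P : probability W R)
    (A : W -> algorithm R S T), solves F eps beta delta P A.

Definition max_noise (R : realType) (S : Type) (F : set (S -> R))
  (eps beta : R) (T : nat) : \bar R :=
  ereal_sup [set delta%:E | delta in
              [set delta : R | 0 <= delta /\ solvable F eps beta delta T]].

(* Main.v *)
Require Import Defs.
From mathcomp Require Import all_boot all_order all_algebra.
From mathcomp Require Import all_classical all_reals all_analysis.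
From mathcomp Require Import measurable_realfun ring lra.
From HB Require Import structures.

Import Order.TTheory GRing.Theory Num.Theory.
Import numFieldNormedType.Exports.

Local Open Scope classical_set_scope.
Local Open Scope ring_scope.

Set Implicit Arguments.
Unset Strict Implicit.
Unset Printing Implicit Defensive.

(* For a unit vector u let F_u be the Moreau-type regularization, of smoothness L,
   of max(G N_u(x) - 4 eps, - 3 eps <u, x> / r), where N_u is the support function
   of the unit ball truncated at <p, u> <= s.  If |<u, x>| <= s |x|, then F_u(x)
   is within the noise level of a radial function F_0(x) that does not depend on
   u, and x is not eps-optimal, because F_u (r u) <= - 3 eps <= F_u(x) - 2 eps.
   Indeed G N_u(x) = G |x| for such x, so that F_u and F_0 essentially
   only differ where |x| <= 6 eps / G, and there by about eps s |x| / r.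
   When u is a normalized random sign vector, each fixed x violates
   |<u, x>| <= s |x| with probability at most 2 exp(- s^2 n / 8).  An oracle that
   answers F_0 whenever this is allowed thus hides u from any algorithm making few
   queries.  The choice s^2 = 8 c log(16 Q) / n makes the exceptional probability
   at most 1 / (8 Q^c), and 1 / G = r s / eps + 1 / sqrt (L eps) the noise
   level small.  If s > 1/6, the claimed bound exceeds 3 eps / 2, and
   a pair of opposite linear functions suffices. *)

(** * Inner product and smoothness *)

Section InnerProduct.
Context {R : realType} {n : nat}.
Implicit Types (x y z : 'rV[R]_n) (a : R).

Definition dot x y : R := \sum_(i < n) x 0 i * y 0 i.

Lemma dotC x y : dot x y = dot y x.
Proof. by apply: eq_bigr => i _; rewrite mulrC. Qed.

Lemma dotDl x y z : dot (x + y) z = dot x z + dot y z.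
Proof. by rewrite -big_split; apply: eq_bigr => i _; rewrite mxE mulrDl. Qed.

Lemma dotZl a x y : dot (a *: x) y = a * dot x y.
Proof. by rewrite mulr_sumr; apply: eq_bigr => i _; rewrite mxE mulrA. Qed.

Lemma dotNl x y : dot (- x) y = - dot x y.
Proof. by rewrite -scaleN1r dotZl mulN1r. Qed.

Lemma dotDr x y z : dot z (x + y) = dot z x + dot z y.
Proof. by rewrite dotC dotDl !(dotC z). Qed.

Lemma dotZr a x y : dot x (a *: y) = a * dot x y.
Proof. by rewrite dotC dotZl dotC. Qed.

Lemma dotNr x y : dot x (- y) = - dot x y.
Proof. by rewrite dotC dotNl dotC. Qed.

Definition dotE := (dotDl, dotDr, dotNl, dotNr, dotZl, dotZr).

Lemma dot0l x : dot 0 x = 0.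
Proof. by rewrite -(scale0r 0) dotZl mul0r. Qed.

Lemma dot_ge0 x : 0 <= dot x x.
Proof. by apply: sumr_ge0 => i _; rewrite -expr2 sqr_ge0. Qed.

Lemma enorm_sqr x : enorm x ^+ 2 = dot x x.
Proof.
rewrite /enorm sqr_sqrtr; first by apply: eq_bigr => i _; rewrite expr2.
by apply: sumr_ge0 => i _; rewrite sqr_ge0.
Qed.

Lemma enorm_ge0 x : 0 <= enorm x.
Proof. exact: sqrtr_ge0. Qed.

Lemma enorm_le x a : 0 <= a -> (enorm x <= a) = (dot x x <= a ^+ 2).
Proof. by move=> a0; rewrite -enorm_sqr ler_sqr ?nnegrE ?enorm_ge0. Qed.

Lemma enorm_eq0 x : (enorm x == 0) = (x == 0).
Proof.
apply/eqP/eqP => [x0|->]; last by rewrite /enorm big1 ?sqrtr0// => i _; rewrite mxE expr0n.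
have /psumr_eq0P x0' : dot x x = 0 by rewrite -enorm_sqr x0 expr0n.
apply/rowP => i; rewrite mxE; apply/eqP; rewrite -sqrf_eq0 expr2.
by apply/eqP/x0' => // j _; rewrite -expr2 sqr_ge0.
Qed.

Lemma dot_le_enorm x y : dot x y <= enorm x * enorm y.
Proof.
have [->|x0] := eqVneq x 0; first by rewrite dot0l mulr_ge0 ?enorm_ge0.
have [->|y0] := eqVneq y 0; first by rewrite dotC dot0l mulr_ge0 ?enorm_ge0.
have xy0 : 0 < enorm x * enorm y.
  by rewrite mulr_gt0 // lt_def enorm_ge0 enorm_eq0 ?x0 ?y0.
have := dot_ge0 (enorm y *: x - enorm x *: y).
rewrite !dotE (dotC y x) -!enorm_sqr; move: xy0; nra.
Qed.

Lemma enormN x : enorm (- x) = enorm x.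
Proof. by congr Num.sqrt; apply: eq_bigr => i _; rewrite mxE sqrrN. Qed.

Lemma normr_dot_le x y : `|dot x y| <= enorm x * enorm y.
Proof.
by rewrite ler_norml dot_le_enorm andbT lerNl -dotNl -(enormN x) dot_le_enorm.
Qed.

Lemma normr_coord_le_enorm x i : `|x 0 i| <= enorm x.
Proof.
rewrite -ler_sqr ?nnegrE ?enorm_ge0 // enorm_sqr real_normK ?num_real //.
rewrite /dot (bigD1 i) //= -expr2 lerDl.
by apply: sumr_ge0 => k _; rewrite -expr2 sqr_ge0.
Qed.

Lemma mx_norm_le_enorm x : `|x| <= enorm x.
Proof.
rewrite [leLHS]/Num.norm/= mx_normrE; apply/bigmax_leP.
by split=> [|[i j] _ /=]; [exact: enorm_ge0|rewrite (ord1 i) normr_coord_le_enorm].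
Qed.

Lemma dot_le_mx_norm x : dot x x <= n%:R * `|x| ^+ 2.
Proof.
have xi i : x 0 i * x 0 i <= `|x| ^+ 2.
  rewrite -expr2 -real_normK ?num_real // ler_sqr ?nnegrE //.
  rewrite [leRHS]/Num.norm/= mx_normrE.
  by apply: (le_bigmax _ (fun k => `|x k.1 k.2|) (0, i)).
apply: (le_trans (ler_sum _ (fun i _ => xi i))).
by rewrite sumr_const card_ord mulr_natl.
Qed.

Lemma enorm_le_mx_norm x : enorm x <= n%:R * `|x|.
Proof.
rewrite enorm_le ?mulr_ge0 // (le_trans (dot_le_mx_norm x)) // exprMn.
by rewrite ler_wpM2r ?exprn_ge0 // -natrX ler_nat; case: (n) => // m; rewrite leq_pmulr.
Qed.

End InnerProduct.

(** * Smooth convex functions from Lipschitz subgradients *)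

Section SmoothConvex.
Context {R : realType} {n : nat}.

Lemma cvg_dot (T : Type) (F : set_system T) (f g : T -> 'rV[R]_n) (a b : 'rV[R]_n) :
  Filter F -> f x @[x --> F] --> a -> g x @[x --> F] --> b ->
  dot (f x) (g x) @[x --> F] --> dot a b.
Proof.
move=> FF fa gb; apply: cvg_big => //; first exact: add_continuous.
move=> i _; apply: (@cvgM R).
  exact: (cvg_comp f (fun M : 'rV[R]_n => M 0 i) fa (@coord_continuous R 1 n 0 i a)).
exact: (cvg_comp g (fun M : 'rV[R]_n => M 0 i) gb (@coord_continuous R 1 n 0 i b)).
Qed.

Lemma dot_continuous (p : 'rV[R]_n) : continuous (dot p).
Proof.
move=> x; apply: (@cvg_dot _ (nbhs x) (fun=> p) id); first exact: cvg_cst.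
exact: cvg_id.
Qed.

Fact dot_linear (p : 'rV[R]_n) : linear (dot p : 'rV[R]_n -> R^o).
Proof. by move=> a x y; rewrite dotDr dotZr. Qed.

HB.instance Definition _ (p : 'rV[R]_n) :=
  GRing.isLinear.Build R 'rV[R]_n R^o *:%R (dot p) (dot_linear p).

Lemma is_diff_littleo (V W : normedModType R) (f : V -> W)
    (df : {linear V -> W}) (x : V) :
  continuous df ->
  (forall e, 0 < e -> \forall h \near 0, `|f (h + x) - f x - df h| <= e * `|h|) ->
  is_diff x f df.
Proof.
move=> dfc fdf.
have fo : f \o shift x = cst (f x) + df +o_ 0 id.
  apply/eqaddoP => e /fdf; apply: filterS => h.
  by rewrite /= opprD !fctE /= addrA.
have dE : 'd f x = df :> (V -> W) by exact: diff_unique.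
by split => //; apply/diff_locallyP; rewrite dE.
Qed.

(** An error quadratic in the Euclidean norm is, up to the factor [n], quadratic in the sup norm,
    hence little-o of the norm that defines differentiability. *)
Lemma differentiable_of_quadratic_error (f : 'rV[R]_n -> R^o) (p x : 'rV[R]_n) (M : R) :
  (forall h, `|f (h + x) - f x - dot p h| <= M * dot h h) ->
  differentiable f x /\ gradient f x = p.
Proof.
move=> fM.
(* [M] may be negative and [n] may be 0; the positive part and the summand 1 keep the divisor below
   positive. *)
have M0 : 0 <= Num.max M 0 by rewrite le_max lexx orbT.
have K0 : 0 < Num.max M 0 * n%:R + 1 by rewrite ltr_wpDl ?mulr_ge0.
have dfx : is_diff x f (dot p : 'rV[R]_n -> R^o).
  apply: is_diff_littleo; first exact: dot_continuous.
  move=> e e0; near=> h.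
  rewrite (le_trans (fM h))//.
  have h1 : `|h| <= e / (Num.max M 0 * n%:R + 1).
    near: h; apply: (@nbhs0_le _ ('rV[R]_n)); exact: divr_gt0.
  apply: (le_trans (ler_wpM2r (dot_ge0 h) (_ : M <= Num.max M 0))).
    by rewrite le_max lexx.
  apply: (le_trans (ler_wpM2l M0 (dot_le_mx_norm h))).
  rewrite mulrA expr2 mulrA ler_wpM2r //.
  rewrite ler_pdivlMr // mulrC in h1.
  by apply: le_trans h1; rewrite ler_wpM2r // lerDl.
have df := @diff_val _ _ _ _ _ _ _ dfx.
split=> //; apply/rowP => i; rewrite mxE deriveE // df.
rewrite /dot (bigD1 i) //= big1 ?addr0.
  by rewrite mxE !eqxx mulr1.
by move=> j ji; rewrite mxE eqxx (negbTE ji) mulr0.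
Unshelve. all: by end_near. Qed.

(** Subgradient inequalities at both ends of a step [h] trap the first-order error between 0 and
    [L * dot h h], so [p] is the gradient. As [f] lives on the whole space, the neighbourhood of the
    ball can be everything. *)
Lemma smooth_convex_of_subgradient (L r : R) (f : 'rV[R]_n -> R)
    (p : 'rV[R]_n -> 'rV[R]_n) :
  0 <= L -> (forall x y, f x + dot (p x) (y - x) <= f y) ->
  (forall x y, enorm (p x - p y) <= L * enorm (x - y)) ->
  smooth_convex n L r (fun x : eball n r => f (\val x)).
Proof.
move=> L0 fp pL.
have dfx x : differentiable f x /\ gradient f x = p x.
  apply: (@differentiable_of_quadratic_error f _ _ L) => h.
  have h1 := fp x (h + x); have h2 := fp (h + x) x.
  rewrite addrK in h1; rewrite opprD addrCA subrr addr0 dotNr in h2.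
  have h3 := dot_le_enorm (p (h + x) - p x) h.
  have := ler_wpM2r (enorm_ge0 h) (pL (h + x) x).
  rewrite addrK -mulrA -expr2 enorm_sqr => h4.
  rewrite dotDl dotNl in h3.
  by rewrite ger0_norm; lra.
exists setT, f; split => //.
- by split; [exact: openT|].
- move=> t x y _ _; rewrite convRE /unstable.onem.
  set z := conv t x y.
  have zE : z = t%:inum *: (x : 'rV[R]_n) + (1 - t%:inum) *: y by [].
  (* The subgradient at [z] is tested at [x] and [y]; the weighted displacements cancel. *)
  have h1 := fp z x; have h2 := fp z y.
  have t0 : 0 <= t%:inum by []. 
  have t1 : 0 <= 1 - t%:inum by rewrite subr_ge0.
  have := lerD (ler_wpM2l t0 h1) (ler_wpM2l t1 h2).
  rewrite !mulrDr -!dotZr addrACA -dotDr -mulrDl subrKC mul1r.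
  suff -> : t%:inum *: (x - z) + (1 - t%:inum) *: (y - z) = 0 by rewrite linear0 addr0.
  rewrite !scalerBr addrACA -opprD -scalerDl subrKC scale1r zE.
  exact: subrr.
- split=> [x _|x _]; first by have [] := dfx x.
  rewrite (_ : gradient f = p); last by apply/funext => y; have [] := dfx y.
  apply/(@cvgrPdist_le _ _ _ (nbhs x)) => e e0; near=> y.
  rewrite (le_trans (mx_norm_le_enorm _)) // (le_trans (pL _ _)) //.
  have h1 : `|x - y| <= e / (L * n%:R + 1).
    near: y; apply: (@cvgr_dist_le _ _ _ (nbhs x) _ id) => //.
    by rewrite divr_gt0 // ltr_wpDl ?mulr_ge0.
  rewrite (le_trans (ler_wpM2l L0 (enorm_le_mx_norm _))) // mulrA.
  rewrite ler_pdivlMr ?ltr_wpDl ?mulr_ge0 // mulrC in h1.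
  by apply: le_trans h1; rewrite ler_wpM2r // lerDl.
- by move=> x y _ _; rewrite (dfx x).2 (dfx y).2.
Unshelve. all: by end_near. Qed.

End SmoothConvex.

(** * Maxima of affine functions with a quadratic penalty on the slope *)

Section MaxOfConcaveQuadratics.
Context {R : realType} {n : nat}.

(* Moreau-type regularity: the quadratic term makes the maximiser depend
   L-Lipschitz continuously on the point. *)
Lemma smooth_convex_max (I : Type) (C : set I) (P : I -> 'rV[R]_n) (t : I -> R)
    (sel : 'rV[R]_n -> I) (L r : R) :
  let v i x := dot (P i) x - dot (P i) (P i) / (2 * L) - t i in
  0 < L ->
  (forall x, C (sel x) /\ forall j, C j -> v j x <= v (sel x) x) ->
  (forall i j (a : R), C i -> C j -> 0 <= a <= 1 -> exists k,
    [/\ C k, P k = P i + a *: (P j - P i) & t k <= t i + a * (t j - t i)]) ->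
  smooth_convex n L r (fun x : eball n r => v (sel (\val x)) (\val x)).
Proof.
move=> v L0 selP Cconv.
apply: (@smooth_convex_of_subgradient R n L r (fun x => v (sel x) x) (P \o sel)).
- exact: ltW.
(* For a fixed index [v] is affine in the point, so the maximising slope at [x] is a subgradient
   there. *)
- move=> x y /=; have [_ /(_ _ (selP x).1)] := selP y.
  apply: le_trans; rewrite le_eqVlt; apply/orP; left; apply/eqP.
  by rewrite /v !dotE; ring.
(* First-order optimality of [sel x] in the direction of [j]: if this expression W were positive, a
   move by a = W / (W + B) would gain at least a W - a^2 B = a^2 W > 0. *)
have vi x j : C j -> dot x (P j - P (sel x)) -
    dot (P (sel x)) (P j - P (sel x)) / L - (t j - t (sel x)) <= 0.
  move=> Cj; have [Ci maxi] := selP x; set i := sel x in Ci maxi *.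
  have [D DE] : exists D, D = P j - P i by exists (P j - P i).
  rewrite -DE; set W := (X in X <= 0).
  rewrite leNgt; apply/negP => W0.
  pose B := dot D D / (2 * L).
  have B0 : 0 <= B by rewrite divr_ge0 ?dot_ge0 // mulr_ge0 // ltW.
  pose a := W / (W + B).
  have WB : 0 < W + B by rewrite ltr_pwDl.
  have a0 : 0 < a by rewrite divr_gt0.
  have a1 : a <= 1 by rewrite ler_pdivrMr // mul1r lerDl.
  have [k [Ck Pk tk]] := Cconv i j a Ci Cj (introT andP (conj (ltW a0) a1)).
  have := maxi k Ck; rewrite /v Pk -DE.
  have aWB : a * (W + B) = W by rewrite /a divfK // gt_eqF.
  have -> : dot (P i + a *: D) x - dot (P i + a *: D) (P i + a *: D) / (2 * L) - t k
     = (dot (P i) x - dot (P i) (P i) / (2 * L) - t i) + a * W - a ^+ 2 * B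
       + (t i + a * (t j - t i) - t k).
    rewrite !dotE (dotC D (P i)) /W /B (dotC x D).
    by field; rewrite gt_eqF.
  move=> h; have : a * W - a ^+ 2 * B <= 0 by lra.
  have : 0 < a * W - a ^+ 2 * B.
    have -> : a * W - a ^+ 2 * B = a ^+ 2 * W by rewrite -{1}aWB; ring.
    by rewrite mulr_gt0 // exprn_gt0.
  lra.
move=> x y /=.
(* Adding the optimality conditions at [x] and at [y] cancels the penalties [t] and leaves |D|^2 / L
   <= <y - x, D>; Cauchy-Schwarz then gives the Lipschitz bound. *)
have [Ci _] := selP x; have [Cj _] := selP y.
have := vi x _ Cj; have := vi y _ Ci.
set i := sel x; set j := sel y.
have -> : P i - P j = - (P j - P i) by rewrite opprB.
have [D DE] : exists D, D = P j - P i by exists (P j - P i).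
rewrite -DE => h1 h2; have Pj : P j = P i + D by rewrite DE addrC subrK.
have h3 : dot D D / L <= dot (y - x) D.
  move: h1 h2; rewrite Pj !dotE => h1 h2; rewrite mulrDl in h1; lra.
rewrite ler_pdivrMr // in h3.
have h4 := le_trans h3 (ler_wpM2r (ltW L0) (dot_le_enorm _ _)).
rewrite enormN -(enormN (x - y)) opprB.
have [D0|D0] := eqVneq (enorm D) 0; first by rewrite D0 mulr_ge0 ?enorm_ge0 ?ltW.
have Dp : 0 < enorm D by rewrite lt_def D0 enorm_ge0.
by rewrite -(ler_pM2r Dp) -expr2 enorm_sqr (le_trans h4) // mulrC mulrA.
Qed.

End MaxOfConcaveQuadratics.

(** * The hard functions *)

Lemma closed_le_continuous (R : realType) (T : topologicalType) (g h : T -> R) :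
  continuous g -> continuous h -> closed [set x | g x <= h x].
Proof.
move=> cg ch.
rewrite (_ : mkset _ = (fun x => g x - h x) @^-1` [set y | y <= 0]).
  apply: closed_comp; last exact: closed_le.
  by move=> x _; apply: (@cvgB R R^o _ (nbhs x)); [exact: cg|exact: ch].
by apply/seteqP; split => x /=; rewrite subr_le0.
Qed.

Section HardFunction.
Context {R : realType} {n : nat}.
Variables (L G s eta A : R) (u : 'rV[R]_n).
Hypotheses (L0 : 0 < L) (G0 : 0 < G).

(* The dual points of a F_1 + (1 - a) F_2, where F_1 = G N_u - A and
   F_2 = - eta <u, _>: the pair (q, a) stands for the slope q of a F_1 and the
   weight a. *)
Definition hard_index : set ('rV[R]_n * R) :=
  [set i | [/\ 0 <= i.2 <= 1, dot i.1 i.1 <= (i.2 * G) ^+ 2 &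
               dot i.1 u <= i.2 * (G * s)]].

Definition hard_slope (i : 'rV[R]_n * R) : 'rV[R]_n :=
  i.1 - ((1 - i.2) * eta) *: u.

Definition hard_value (i : 'rV[R]_n * R) (x : 'rV[R]_n) : R :=
  dot (hard_slope i) x - dot (hard_slope i) (hard_slope i) / (2 * L) - i.2 * A.

(** Since weights are at most 1, slopes have norm at most [G], and the index set is a closed subset
    of a compact box. *)
Lemma hard_index_compact : compact hard_index.
Proof.
pose box := [set q : 'rV[R]_n | forall i, q ord0 i \in `[- G, G]].
have cbox : compact (box `*` `[(0 : R), 1]%classic).
  apply: compact_setX; last exact: segment_compact.
  apply: (@rV_compact _ _ (fun=> `[- G, G]%classic)).
  by move=> _; exact: segment_compact.
apply: subclosed_compact cbox _; last first.
  move=> [q a] [/= /andP[a0 a1] qG _]; split => /=; last by rewrite in_itv/= a0 a1.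
  move=> i; rewrite in_itv /= -ler_norml.
  have : enorm q <= G.
    have G0' := ltW G0.
    rewrite enorm_le // (le_trans qG) // ler_sqr ?nnegrE ?mulr_ge0 //.
    by rewrite ler_piMl.
  exact: le_trans (normr_coord_le_enorm _ _).
rewrite (_ : hard_index = [set i | 0 <= i.2] `&` [set i | i.2 <= 1] `&`
  [set i | dot i.1 i.1 <= (i.2 * G) ^+ 2] `&` [set i | dot i.1 u <= i.2 * (G * s)]).
  have csnd (c : R) : continuous (fun i : 'rV[R]_n * R => i.2 * c).
    by move=> x; apply: (@cvgM R); [exact: cvg_snd|exact: cvg_cst].
  repeat apply: closedI; apply: closed_le_continuous.
  - exact: cst_continuous.
  - by move=> x; exact: cvg_snd.
  - by move=> x; exact: cvg_snd.
  - exact: cst_continuous.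
  - by move=> x; apply: (@cvg_dot R n _ (nbhs x)); exact: cvg_fst.
  - by move=> x; apply: (@cvgM R); exact: csnd.
  - by move=> x; apply: (@cvg_dot R n _ (nbhs x)); [exact: cvg_fst|exact: cvg_cst].
  - exact: csnd.
apply/seteqP; split => -[q a] /=; first by move=> [/andP[? ?] ? ?].
by move=> [[[? ?] ?] ?]; split => //; apply/andP.
Qed.

Lemma hard_value_continuous x : continuous (hard_value ^~ x).
Proof.
have cslope : continuous hard_slope.
  move=> i; apply: (@cvgB R 'rV[R]_n _ (nbhs i)); first exact: cvg_fst.
  apply: (@cvgZ R 'rV[R]_n _ (nbhs i)); last exact: cvg_cst.
  apply: (@cvgM R); last exact: cvg_cst.
  by apply: (@cvgB R R^o _ (nbhs i)); [exact: cvg_cst|exact: cvg_snd].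
move=> i; apply: (@cvgB R R^o _ (nbhs i)).
  apply: (@cvgB R R^o _ (nbhs i)).
    by apply: (@cvg_dot R n _ (nbhs i)); [exact: cslope|exact: cvg_cst].
  apply: (@cvgM R); last exact: cvg_cst.
  by apply: (@cvg_dot R n _ (nbhs i)); exact: cslope.
by apply: (@cvgM R); [exact: cvg_snd|exact: cvg_cst].
Qed.

(** Maximisers exist by compactness. The bounds on the slope scale with the weight, so the
    constraints are jointly convex in the pair (q, a), and [hard_slope] is affine in it;
    [smooth_convex_max] applies. *)
Lemma hard_function_exists (r : R) : exists F : 'rV[R]_n -> R,
  [/\ smooth_convex n L r (fun x : eball n r => F (\val x)),
      forall x, exists2 i, hard_index i & F x = hard_value i x &
      forall i x, hard_index i -> hard_value i x <= F x].
Proof.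
have ne : hard_index !=set0.
  exists (0, 0); split => /=; first by rewrite lexx ler01.
    by rewrite dot0l mul0r expr0n.
  by rewrite dot0l mul0r.
have /choice[sel selP] x : exists i, hard_index i /\
    forall j, hard_index j -> hard_value j x <= hard_value i x.
  have [|i] := @compact_EVT_max _ R (hard_value ^~ x) _ ne hard_index_compact.
    apply: continuous_subspaceT; exact: hard_value_continuous.
  rewrite inE => Ci maxi; exists i; split => // j Cj; apply: maxi.
  by rewrite inE.
exists (fun x => hard_value (sel x) x); split.
- apply: (@smooth_convex_max R n _ hard_index hard_slope (fun i => i.2 * A)) => //.
  move=> [p a] [q b] c [/= /andP[a0 a1] pa pu] [/= /andP[b0 b1] qb qu] /andP[c0 c1].
  have c1' : 0 <= 1 - c by rewrite subr_ge0.
  exists (p + c *: (q - p), a + c * (b - a)); split => /=.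
  + have E : dot (p + c *: (q - p)) (p + c *: (q - p)) =
      (1 - c) ^+ 2 * dot p p + 2 * c * (1 - c) * dot p q + c ^+ 2 * dot q q.
      by rewrite !dotE (dotC q p); ring.
    split => /=.
    * by apply/andP; split; nra.
    * rewrite E -enorm_sqr -enorm_sqr.
      have pG : enorm p <= a * G by rewrite enorm_le // mulr_ge0 // ltW.
      have qG : enorm q <= b * G by rewrite enorm_le // mulr_ge0 // ltW.
      have h : dot p q <= enorm p * enorm q := dot_le_enorm _ _.
      have e0 := enorm_ge0 p; have f0 := enorm_ge0 q.
      apply: (@le_trans _ _ (((1 - c) * enorm p + c * enorm q) ^+ 2)).
        have : 0 <= 2 * c * (1 - c) by rewrite !mulr_ge0.
        by move=> h2; have := ler_wpM2l h2 h; lra.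
      rewrite ler_sqr ?nnegrE.
      - have -> : (a + c * (b - a)) * G = (1 - c) * (a * G) + c * (b * G) by ring.
        by rewrite lerD // ler_wpM2l.
      - by rewrite addr_ge0 // mulr_ge0 // enorm_ge0.
      - rewrite mulr_ge0 ?(ltW G0) //.
        have -> : a + c * (b - a) = (1 - c) * a + c * b by ring.
        by rewrite addr_ge0 // mulr_ge0.
    * rewrite !dotE; have := ler_wpM2l c1' pu; have := ler_wpM2l c0 qu; lra.
  + rewrite /hard_slope /=; apply/rowP => k; rewrite !mxE; ring.
  + by rewrite le_eqVlt; apply/orP; left; apply/eqP; ring.
- by move=> x; exists (sel x) => //; exact: (selP x).1.
- by move=> i x; exact: (selP x).2.
Qed.

End HardFunction.

(** The maximiser is the vertex b / (2 a) clipped to the unit interval. *)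
Lemma concave_quadratic_max (R : realType) (a b : R) : 0 < a ->
  exists2 c, 0 <= c <= 1 &
    forall d, 0 <= d <= 1 -> d * b - d ^+ 2 * a <= c * b - c ^+ 2 * a.
Proof.
move=> a0; have [b0|b0] := leP b 0.
  exists 0; first by rewrite lexx ler01.
  move=> d /andP[d0 _]; rewrite mul0r expr0n mul0r subrr.
  have : 0 <= d ^+ 2 * a by rewrite mulr_ge0 ?sqr_ge0 // ltW.
  have := mulr_ge0_le0 d0 b0; lra.
have [ba|ba] := leP (2 * a) b.
  exists 1; first by rewrite lexx ler01.
  move=> d /andP[d0 d1].
  have : d * a <= a by rewrite ler_piMl // ltW.
  move=> da; have : 0 <= (1 - d) * (b - a - d * a) by rewrite mulr_ge0; lra.
  by lra.
pose c := b / (2 * a).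
have a2 : 0 < 2 * a by rewrite mulr_gt0.
have cE : b = c * (2 * a) by rewrite divfK // gt_eqF.
exists c; first by rewrite divr_ge0 ?(ltW b0) ?(ltW a2) //= ler_pdivrMr // mul1r ltW.
move=> d _; rewrite -subr_ge0 cE.
have -> : c * (c * (2 * a)) - c ^+ 2 * a - (d * (c * (2 * a)) - d ^+ 2 * a) =
  (c - d) ^+ 2 * a by ring.
by rewrite mulr_ge0 ?sqr_ge0 // ltW.
Qed.

(** * Estimates for the functions F_u and the radial function F_0 *)

Section HardFamily.
Context {R : realType} {n : nat}.
Variables (L r e s G : R).
Hypotheses (L0 : 0 < L) (r0 : 0 < r) (e0 : 0 < e) (G0 : 0 < G).
Hypotheses (s0 : 0 <= s) (s6 : s <= 1 / 6).
Hypotheses (Gs : G * s * r <= e) (G2 : G ^+ 2 <= L * e) (eLr : 9 * e <= L * r ^+ 2).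

Variables (eta A c : R).
Hypotheses (eta_r : eta * r = 3 * e) (AE : A = 4 * e) (cL : c * (2 * L) = 1).

Let c0 : 0 < c. Proof. by rewrite -(pmulr_lgt0 _ (_ : 0 < 2 * L)) ?cL ?mulr_gt0. Qed.
Let eta0 : 0 <= eta.
Proof. by rewrite -(pmulr_lge0 _ r0) eta_r mulr_ge0 // ltW. Qed.
Let A0 : 0 <= A. Proof. by rewrite AE mulr_ge0 // ltW. Qed.
Let cG : 2 * c * G ^+ 2 <= e.
Proof.
have := ler_wpM2l (ltW c0) G2; have -> : c * (L * e) = (c * (2 * L)) * e / 2 by field.
by rewrite cL; lra.
Qed.

(** The contributions of [u] where |<u, x>| <= s |x|: the linear part within radius 6 e / G, then
    the cross term and the square of the linear slope in the regularization. *)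
Definition hard_error : R := eta * s * (6 * e / G) + 2 * c * eta * G * s + c * eta ^+ 2.

(* Beyond radius 6 e / G the maximum over the weight a is attained at a = 1, with
   enough slack to absorb the linear term. *)
Let far (m a rho : R) : 0 <= a <= 1 -> 0 <= m -> m <= a * G -> rho <= r ->
  6 * e <= G * rho ->
  m * rho - c * m ^+ 2 - a * A + (1 - a) * eta * s * rho <= G * rho - c * G ^+ 2 - A.
Proof.
move=> /andP[a0 a1] m0 ma rr Gr.
(* lra ignores section hypotheses *)
have [e0' G0' cG' c0'] := And4 e0 G0 cG c0; have [eta0' A0'] := conj eta0 A0.
have a1' : 0 <= 1 - a by rewrite subr_ge0.
have h1 : 2 * c * G <= rho.
  rewrite -(ler_pM2l G0) (_ : G * (2 * c * G) = 2 * c * G ^+ 2); last by ring.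
  by apply: (le_trans cG); apply: le_trans Gr; rewrite ler_peMl ?ler1n // ltW.
have aG : a * G <= G by rewrite ler_piMl // ltW.
have mG : 0 <= G - m by lra.
have rho0 : 0 <= rho by apply: le_trans h1; rewrite !mulr_ge0 // ltW.
have h2 : eta * s * rho <= e / 2.
  have : eta * s * rho <= eta * s * r by rewrite ler_wpM2l // mulr_ge0.
  have -> : eta * s * r = s * (3 * e) by rewrite -eta_r; ring.
  have : s * (3 * e) <= 1 / 6 * (3 * e) by rewrite ler_wpM2r // mulr_ge0 // ltW.
  by lra.
(* The budget: [G * rho] is at least 6 e, while the three subtracted terms are at most e, 4 e and e
   / 2. *)
have h3 : 0 <= (1 - a) * (G * rho - 2 * c * G ^+ 2 - A - eta * s * rho).
  by rewrite mulr_ge0 // AE; lra.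
(* The gain from [m] to [G] is (G - m) (rho - 2 c G) + c (G - m)^2, and G - m >= (1 - a) G. *)
have h4 : (1 - a) * G * (rho - 2 * c * G) <= (G - m) * (rho - 2 * c * G).
  by rewrite ler_wpM2r ?subr_ge0 //; lra.
have h5 : 0 <= c * (G - m) ^+ 2 by rewrite mulr_ge0 ?sqr_ge0 // ltW.
by lra.
Qed.

(** The value of weight [a] with slope of norm [a * G] along [x], all terms in [u] dropped. Its
    maximum over the weight is the radial function F_0. *)
Let k (rho a : R) := a * (G * rho - A) - a ^+ 2 * (c * G ^+ 2).

Lemma hard_value_expand (u x : 'rV[R]_n) (q : 'rV[R]_n) (a : R) : dot u u = 1 ->
  hard_value L eta A u (q, a) x =
  dot q x - (1 - a) * eta * dot u x -
  c * (dot q q - 2 * (1 - a) * eta * dot q u + ((1 - a) * eta) ^+ 2) - a * A.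
Proof.
have L2 : 2 * L != 0 by rewrite gt_eqF // mulr_gt0.
have -> : c = (2 * L)^-1 by apply: (mulIf L2); rewrite cL mulVf.
move=> u1; rewrite /hard_value /hard_slope /= !dotE u1 (dotC u q); ring.
Qed.

(** Beyond radius 6 e / G, [far] compares with weight 1. Within it, a slope of norm m is compared
    with weight b = m / G <= a, which only lowers the penalty [a * A]; the terms in [u] go into
    [hard_error]. *)
Lemma hard_value_le (u x : 'rV[R]_n) (f0 : R) i : dot u u = 1 -> enorm x <= r ->
  `|dot u x| <= s * enorm x -> (forall a, 0 <= a <= 1 -> k (enorm x) a <= f0) ->
  hard_index G s u i -> hard_value L eta A u i x <= f0 + hard_error.
Proof.
have [e0' G0' cG' c0'] := And4 e0 G0 cG c0; have [eta0' A0'] := conj eta0 A0.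
case: i => q a u1 xr ux kf [/= a01 qG qu]; rewrite hard_value_expand //.
have /andP[a0 a1] := a01; have a1' : 0 <= 1 - a by rewrite subr_ge0.
set rho := enorm x in xr ux kf *; have rho0 : 0 <= rho by exact: enorm_ge0.
have qm : enorm q <= a * G by rewrite enorm_le // mulr_ge0 // ltW.
have qx : dot q x <= enorm q * rho by exact: dot_le_enorm.
rewrite -(enorm_sqr q); move: (enorm q) (enorm_ge0 q) qm qx => m m0 qm qx.
have zl : - (s * rho) <= dot u x by move: ux; rewrite ler_norml => /andP[].
have b0 : 0 <= (1 - a) * eta by rewrite mulr_ge0.
have h1 : - ((1 - a) * eta * dot u x) <= (1 - a) * eta * s * rho.
  by have := ler_wpM2l b0 zl; lra.
have h2 : 2 * c * ((1 - a) * eta * dot q u) <= 2 * c * eta * G * s.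
  have t0 : 0 <= eta * (G * s) by rewrite !mulr_ge0 // ltW.
  have h3 := ler_wpM2l b0 qu.
  have h4 : (1 - a) * a * (eta * (G * s)) <= 1 * (eta * (G * s)).
    by rewrite ler_wpM2r // mulr_ile1 // lerBlDr lerDl.
  have h5 : (1 - a) * eta * dot q u <= eta * (G * s) by lra.
  have := ler_wpM2l (ltW c0) h5; lra.
have h3 : 0 <= c * ((1 - a) * eta) ^+ 2 by rewrite mulr_ge0 ?sqr_ge0 // ltW.
have h4 : 0 <= c * eta ^+ 2 by rewrite mulr_ge0 ?sqr_ge0 // ltW.
rewrite /hard_error; have [rG|rG] := leP (6 * e) (G * rho).
  have := far a01 m0 qm xr rG.
  have := kf 1; rewrite lexx ler01 => /(_ isT); rewrite /k.
  have : 0 <= eta * s * (6 * e / G) by rewrite !mulr_ge0 ?invr_ge0 ?(ltW G0) ?(ltW e0).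
  by lra.
have h5 : rho <= 6 * e / G by rewrite ler_pdivlMr // mulrC ltW.
have h6 : (1 - a) * eta * s * rho <= eta * s * (6 * e / G).
  have t0 : 0 <= eta * s by rewrite mulr_ge0.
  have := ler_wpM2l t0 h5; have := mulr_ge0 a0 (mulr_ge0 t0 rho0); lra.
pose b := m / G.
have bE : m = b * G by rewrite divfK // gt_eqF.
have b01 : 0 <= b <= 1.
  rewrite divr_ge0 ?(ltW G0) //= ler_pdivrMr // mul1r (le_trans qm) //.
  by rewrite ler_piMl // ltW.
have ba : b <= a by rewrite ler_pdivrMr.
have := kf b b01; rewrite /k.
have : b * A <= a * A by rewrite ler_wpM2r.
rewrite bE in qx *; lra.
Qed.

(** The slope along [x] of norm [b * G] (zero if [x] is zero) attains the radial value, and is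
    admissible because <u, x> <= s |x|. *)
Lemma hard_value_ge (u x : 'rV[R]_n) (a : R) : dot u u = 1 -> enorm x <= r ->
  `|dot u x| <= s * enorm x -> 0 <= a <= 1 ->
  exists2 i, hard_index G s u i & k (enorm x) a - hard_error <= hard_value L eta A u i x.
Proof.
have [e0' G0' cG' c0'] := And4 e0 G0 cG c0; have [eta0' A0'] := conj eta0 A0.
move=> u1 xr ux.
(* Only the linear part, of weight 1 - b, involves [u], whence the factor 1 - b in the error. *)
have key b : 0 <= b <= 1 -> exists2 i, hard_index G s u i &
    k (enorm x) b - (1 - b) * (eta * s * enorm x + 2 * c * eta * G * s + c * eta ^+ 2)
      <= hard_value L eta A u i x.
  move=> /andP[b0 b1]; have b1' : 0 <= 1 - b by rewrite subr_ge0.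
  set rho := enorm x in ux *; have rho0 : 0 <= rho by exact: enorm_ge0.
  (* also correct at x = 0, where b * G / rho = 0 *)
  pose q := (b * G / rho) *: x.
  have qx : dot q x = b * G * rho.
    rewrite dotZl -enorm_sqr -/rho; have [->|rn] := eqVneq rho 0.
      by rewrite invr0 !mulr0 mul0r.
    by field.
  have qq : dot q q <= (b * G) ^+ 2.
    rewrite dotZr qx; have [->|rn] := eqVneq rho 0.
      by rewrite invr0 mulr0 mul0r sqr_ge0.
    by rewrite le_eqVlt; apply/orP; left; apply/eqP; field.
  have qu : `|dot q u| <= b * (G * s).
    rewrite dotZl dotC normrM; have [rz|rn] := eqVneq rho 0.
      by rewrite rz invr0 mulr0 normr0 mul0r !mulr_ge0 // ltW.
    rewrite ger0_norm; last by rewrite !mulr_ge0 ?invr_ge0 // ltW.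
    have t : 0 <= b * G / rho by rewrite !mulr_ge0 ?invr_ge0 // ltW.
    rewrite (le_trans (ler_wpM2l t ux)) // le_eqVlt; apply/orP; left; apply/eqP.
    by field.
  move: qu; rewrite ler_norml => /andP[qul qur].
  exists (q, b); first by split => //=; apply/andP.
  rewrite hard_value_expand // qx.
  have zu : dot u x <= s * rho by move: ux; rewrite ler_norml => /andP[].
  have d0 : 0 <= (1 - b) * eta by rewrite mulr_ge0.
  have h1 := ler_wpM2l d0 zu.
  have h2 := ler_wpM2l (ltW c0) qq.
  have h3 := ler_wpM2l (ltW c0) (ler_wpM2l d0 qul).
  have h4 : (1 - b) * (2 * c * eta * G * s) * b <= (1 - b) * (2 * c * eta * G * s).
    by rewrite ler_piMr // !mulr_ge0 // ltW.
  have h5 : c * ((1 - b) * eta) ^+ 2 <= (1 - b) * (c * eta ^+ 2).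
    rewrite exprMn mulrCA ler_wpM2r ?mulr_ge0 ?sqr_ge0 ?(ltW c0) //.
    by rewrite expr2 ler_piMl // lerBlDr lerDl.
  by rewrite /k; lra.
move=> a01; have [rG|rG] := leP (6 * e) (G * enorm x).
  (* At weight 1 the error vanishes, and by [far] this weight dominates all others here. *)
  have [|i iH] := key 1; first by rewrite ler01 lexx.
  rewrite subrr mul0r subr0 => h; exists i => //; apply: le_trans h.
  have /andP[a0 a1] := a01.
  have aG0 : 0 <= a * G by rewrite mulr_ge0 // ltW.
  have := far a01 aG0 (lexx _) xr rG.
  have : 0 <= (1 - a) * eta * s * enorm x.
    by rewrite !mulr_ge0 ?enorm_ge0 ?subr_ge0.
  have : 0 <= hard_error.
    by rewrite !addr_ge0 // ?mulr_ge0 ?sqr_ge0 // ?invr_ge0 // ltW.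
  by rewrite /k; lra.
have [i iH h] := key a a01; exists i => //; apply: le_trans h.
have /andP[a0 a1] := a01.
rewrite lerD2l lerN2 /hard_error.
have h5 : enorm x <= 6 * e / G by rewrite ler_pdivlMr // mulrC ltW.
have t0 : 0 <= eta * s by rewrite mulr_ge0.
have h6 := ler_wpM2l t0 h5.
set X := (Y in (1 - a) * Y); apply: (@le_trans _ _ X).
  rewrite ler_piMl ?lerBlDr ?lerDl // !addr_ge0 // ?mulr_ge0 ?sqr_ge0 ?enorm_ge0 //.
  - exact: ltW.
  - exact: ltW.
  - exact: ltW.
by rewrite /X !lerD2r.
Qed.

Lemma hard_family_exists :
  exists (F : 'rV[R]_n -> 'rV[R]_n -> R) (F0 : 'rV[R]_n -> R),
  forall u, dot u u = 1 ->
  [/\ smooth_convex n L r (fun x : eball n r => F u (\val x)),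
      forall x, enorm x <= r -> `|dot u x| <= s * enorm x ->
        `|F u x - F0 x| <= hard_error /\ - e <= F u x &
      F u (r *: u) <= - (3 * e)].
Proof.
have [e0' G0' cG' c0'] := And4 e0 G0 cG c0; have [eta0' A0'] := conj eta0 A0.
have /choice[F HF] u := @hard_function_exists R n L G s eta A u L0 G0 r.
have cG2 : 0 < c * G ^+ 2 by rewrite mulr_gt0 // exprn_gt0.
have /choice[a Ha] (rho : R) : exists a, 0 <= a <= 1 /\
    forall d, 0 <= d <= 1 -> k rho d <= k rho a.
  by have [a ? ?] := concave_quadratic_max (G * rho - A) cG2; exists a; split.
exists F, (fun x => k (enorm x) (a (enorm x))) => u u1.
have [sF Fi iF] := HF u; split => //.
- move=> x xr ux; have [a01 amax] := Ha (enorm x); split.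
    rewrite ler_distl; apply/andP; split.
      have [i iH h] := hard_value_ge u1 xr ux a01.
      exact: (le_trans h (iF i x iH)).
    have [i iH ->] := Fi x.
    exact: hard_value_le.
  (* The index (0, 0) is the linear part alone; its value is at least - 3 e s - e / 2 >= - e, as s
     <= 1 / 6 and 9 e <= L r^2. *)
  apply: (le_trans _ (iF (0, 0) x _)); last first.
    by split => /=; rewrite ?dot0l ?mul0r ?expr0n ?lexx ?ler01.
  rewrite hard_value_expand // !dot0l (_ : _ - _ * A = - (eta * dot u x) - c * eta ^+ 2);
    last by ring.
  have : dot u x <= s * r.
    by move: ux; rewrite ler_norml => /andP[_ /le_trans]; apply; rewrite ler_wpM2l.
  move=> /(ler_wpM2l eta0).
  have -> : eta * (s * r) = s * (3 * e) by rewrite -eta_r; ring.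
  have : c * eta ^+ 2 <= e / 2.
    have r2 : 0 < r ^+ 2 by rewrite exprn_gt0.
    rewrite -(ler_pM2r r2).
    have -> : c * eta ^+ 2 * r ^+ 2 = 9 * (c * e) * e by rewrite -mulrA -exprMn eta_r; ring.
    have : e * c * (9 * e) <= e * c * (L * r ^+ 2).
      by rewrite ler_wpM2l // mulr_ge0 // ltW.
    have -> : e * c * (L * r ^+ 2) = (c * (2 * L)) * (e / 2 * r ^+ 2) by field.
    by rewrite cL; lra.
  have : s * (3 * e) <= 1 / 6 * (3 * e) by rewrite ler_wpM2r // mulr_ge0 // ltW.
  by lra.
(* The shift A = 4 e balances here: the value of any index is at most b e - (1 - b) 3 e - 4 b e = -
   3 e, the regularization being subtracted. *)
have [[q b] [/= /andP[b0 b1] qq qu] ->] := Fi (r *: u).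
rewrite hard_value_expand // !dotZr u1 mulr1.
have h1 := ler_wpM2l (ltW r0) qu.
have h2 := ler_wpM2l b0 Gs.
have h3 : 0 <= c * (dot q q - 2 * (1 - b) * eta * dot q u + ((1 - b) * eta) ^+ 2).
  have -> : dot q q - 2 * (1 - b) * eta * dot q u + ((1 - b) * eta) ^+ 2 =
     dot (q - ((1 - b) * eta) *: u) (q - ((1 - b) * eta) *: u).
     by rewrite !dotE u1 (dotC u q); ring.
  by rewrite mulr_ge0 ?dot_ge0 // ltW.
have h4 : (1 - b) * eta * r = (1 - b) * (3 * e) by rewrite -mulrA eta_r.
by rewrite h4 AE; lra.
Qed.

End HardFamily.

(** * Averaging over a finite family *)

(** On the path that [O0] takes through the tree, each query x spoils only the indices in [B x]; all
    others follow the same path. [C] is the union of the spoiled sets over at most [T] queries. *)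
Lemma run_agree (R : realType) (S : Type) (K : finType) (T : nat) (a : algorithm R S T)
    (O0 : S -> R) (O : K -> S -> R) (B : S -> {set K}) (N : R) :
  (forall x i, i \notin B x -> O i x = O0 x) -> (forall x, #|B x|%:R <= N) ->
  exists2 C : {set K}, #|C|%:R <= T%:R * N &
    forall i, i \notin C -> run (O i) a = run O0 a.
Proof.
move=> OB BN; elim: a => [T' x|T' x k IH] /=.
  exists finset.set0; rewrite ?cards0 // mulr_ge0 //.
  exact: le_trans (BN x).
have [C CN Ci] := IH (O0 x); exists (B x :|: C)%SET.
  rewrite -natr1 mulrDl mul1r addrC (le_trans _ (lerD (BN x) CN)) //.
  by rewrite -natrD ler_nat leq_card_setU.
move=> i; rewrite inE negb_or => /andP[iB iC].
by rewrite OB // Ci.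
Qed.

Section Averaging.
Context {R : realType} {d : measure_display} {W : measurableType d}.
Variable P : probability W R.

(** Double counting: the sum is the integral of the number of events containing w, which is at most
    [N]. *)
Lemma sum_probability_le (K : finType) (E : K -> set W) (N : R) :
  (forall i, measurable (E i)) -> (forall w, #|[set i | w \in E i]%SET|%:R <= N) ->
  (\sum_(i : K) P (E i) <= N%:E)%E.
Proof.
move=> mE EN.
have mf i : measurable_fun [set: W] (EFin \o (\1_(E i) : W -> R)).
  by apply/measurable_EFinP; exact: measurable_indic.
rewrite (eq_bigr (fun i => \int[P]_w (\1_(E i) w : R)%:E)%E); last first.
  by move=> i _; rewrite integral_indic // setIT.
rewrite -ge0_integral_sum //.
have -> : (N%:E = \int[P]_w (cst N%:E w) :> \bar R)%E.
  by rewrite integral_cst // [X in (_ * X)%E]probability_setT mule1.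
apply: ge0_le_integral => //.
- by move=> w _; apply: sume_ge0 => i _; rewrite lee_fin.
- exact: emeasurable_sum.
- move=> w _; rewrite sumEFin lee_fin.
  rewrite (eq_bigr (fun i => (w \in E i)%:R)); last by move=> i _; rewrite indicE.
  rewrite -natr_sum (le_trans _ (EN w)) // ler_nat -sum1_card [leqRHS]big_mkcond /=.
  by apply: leq_sum => i _; rewrite inE; case: (w \in E i).
Qed.

End Averaging.

(* Yao's minimax principle, for oracles that answer F0 whenever they may. *)
Lemma not_solvable_of_family (R : realType) (S : Type) (K : finType)
    (F : set (S -> R)) (eps beta delta N1 N2 : R) (T : nat)
    (f : K -> S -> R) (F0 : S -> R) (y : K -> S) :
  beta < 1 / 2 -> 0 <= delta -> (0 < #|K|)%N ->
  (forall i, F (f i)) ->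
  (forall x, #|[set i | ~~ (`|f i x - F0 x| <= delta)%R]%SET|%:R <= N1) ->
  (forall x, #|[set i | (f i x - f i (y i) <= eps)%R]%SET|%:R <= N2) ->
  (T%:R * N1 + N2) * 2 <= #|K|%:R ->
  ~ solvable F eps beta delta T.
Proof.
move=> b2 d0 K0 Ff fN1 fN2 NK [d [W [P [A sol]]]].
pose O i x := if `|f i x - F0 x| <= delta then F0 x else f i x.
have nO i : noisy_oracle delta (f i) (O i).
  apply: ge_ereal_sup => _ [x _ <-]; rewrite lee_fin /O.
  by case: ifPn => h; rewrite ?subrr ?normr0 // distrC.
have /choice[E HE] i : exists E : set W, [/\ measurable E,
    E `<=` [set w | f i (run (O i) (A w)) - f i (y i) <= eps] &
    ((1 - beta)%:E <= P E)%E].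
  (* The infimum is at most the value at [y i], so success implies near-optimality relative to
     [y i]. *)
  have [E [mE sE PE]] := sol (f i) (Ff i) (O i) (nO i); exists E; split => //.
  move=> w /sE /= h; rewrite -lee_fin; apply: le_trans h.
  rewrite EFinB leeD2l // leeN2; apply: ereal_inf_lbound.
  by exists (y i).
(* For fixed randomness, an index outside [C] can succeed only if the output common to all such
   indices is near-optimal for it. *)
have EN w : #|[set i | w \in E i]%SET|%:R <= T%:R * N1 + N2.
  have [|C CN Ci] := @run_agree R S K T (A w) F0 O
    (fun x => [set i | ~~ (`|f i x - F0 x| <= delta)%R]%SET) N1 _ fN1.
    by move=> x i; rewrite inE negbK /O => ->.
  apply: (@le_trans _ _ #|(C :|: [set i | (f i (run F0 (A w)) - f i (y i) <= eps)%R])%SET|%:R).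
    rewrite ler_nat; apply/subset_leq_card/fintype.subsetP => i; rewrite !inE => wE.
    have [//|/= iC] := boolP (i \in C).
    by have [_ /(_ _ wE) /= + _] := HE i; rewrite Ci.
  apply: (le_trans _ (lerD CN (fN2 (run F0 (A w))))).
  by rewrite -natrD ler_nat leq_card_setU.
(* Averaging over [K] would force 1 - beta <= 1 / 2. *)
have := @sum_probability_le R d W P K E _ (fun i => let: And3 h _ _ := HE i in h) EN.
have : (\sum_(i : K) (1 - beta)%:E <= \sum_(i : K) P (E i))%E.
  by apply: lee_sum => i _; have [] := HE i.
move=> /le_trans /[apply]; rewrite sumEFin lee_fin sumr_const -[leLHS]mulr_natr.
have -> : #|xpredT : pred K| = #|K| by exact: eq_card.
have : 0 < (1 / 2 - beta) * #|K|%:R by rewrite mulr_gt0 ?subr_gt0 // ltr0n.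
lra.
Qed.

(** * Concentration of random signs *)

(** A weak form of cosh x <= exp (x^2 / 2), deduced from 1 + x <= exp x: for 0 <= x < 1 / 2 the sum
    is at most 1 / (1 - x) + 1 / (1 + x), and for larger x one has x <= 2 x^2. *)
Lemma expR_add_expRN_le (R : realType) (x : R) :
  expR x + expR (- x) <= 2 * expR (2 * x ^+ 2).
Proof.
wlog x0 : x / 0 <= x.
  move=> h; have [/h//|/ltW x0] := leP 0 x.
  by have := h (- x); rewrite oppr_ge0 sqrrN opprK addrC; apply.
have [x2|x2] := leP (1 / 2) x.
  have : expR x <= expR (2 * x ^+ 2) by rewrite ler_expR; nra.
  have : expR (- x) <= expR x by rewrite ler_expR; lra.
  by lra.
have e1 : expR x <= (1 - x)^-1.
  rewrite -[leLHS]invrK lef_pV2 ?posrE ?invr_gt0 ?expR_gt0 ?subr_gt0 //; last by lra.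
  by rewrite -expRN (le_trans _ (expR_ge1Dx _)).
have e2 : expR (- x) <= (1 + x)^-1.
  rewrite expRN lef_pV2 ?posrE ?expR_gt0 ?expR_ge1Dx //; lra.
have e3 : 1 + 2 * x ^+ 2 <= expR (2 * x ^+ 2) := expR_ge1Dx _.
have e4 : (1 - x)^-1 + (1 + x)^-1 = 2 * (1 - x ^+ 2)^-1.
  field; apply/and3P; split; apply/eqP; nra.
have e5 : (1 - x ^+ 2)^-1 <= 1 + 2 * x ^+ 2.
  have x1 : 0 < 1 - x ^+ 2 by nra.
  have h : 0 <= x ^+ 2 * (1 - 2 * x ^+ 2) by rewrite mulr_ge0 ?sqr_ge0 //; nra.
  by rewrite -[leLHS]mul1r ler_pdivrMr //; lra.
by lra.
Qed.

Section SignVectors.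
Context {R : realType} {n : nat}.
Implicit Types (x : 'rV[R]_n) (f : {ffun 'I_n -> bool}).

Definition sign_vec f : 'rV[R]_n := \row_i (-1) ^+ f i.

Lemma dot_sign_vec f : dot (sign_vec f) (sign_vec f) = n%:R.
Proof.
rewrite /dot (eq_bigr (fun=> 1)); last by move=> i _; rewrite mxE -expr2 sqrr_sign.
by rewrite sumr_const card_ord.
Qed.

(** The exponential moment factorizes over the independent coordinates. *)
Lemma sum_expR_dot_le x :
  \sum_f expR (dot (sign_vec f) x) <= 2 ^+ n * expR (2 * dot x x).
Proof.
have -> : \sum_f expR (dot (sign_vec f) x) = \prod_i (expR (x 0 i) + expR (- x 0 i)).
  rewrite (eq_bigr (fun f => \prod_i (expR ((-1) ^+ f i * x 0 i)))); last first.
    by move=> f _; rewrite -expR_sum; congr expR; apply: eq_bigr => i _; rewrite mxE.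
  rewrite -(bigA_distr_bigA (fun i (b : bool) => expR ((-1) ^+ b * x 0 i))).
  by apply: eq_bigr => i _; rewrite big_bool /= expr1 expr0 mul1r mulN1r addrC.
have -> : 2 ^+ n * expR (2 * dot x x) = \prod_i (2 * expR (2 * x 0 i ^+ 2)).
  rewrite big_split /= prodr_const card_ord -expR_sum; congr (_ * expR _).
  by rewrite /dot mulr_sumr.
apply: ler_prod => i _; rewrite expR_add_expRN_le andbT.
by rewrite addr_ge0 ?expR_ge0.
Qed.

Lemma card_dot_gt_le x (t : R) : 0 <= t ->
  #|[set f | t * enorm x < dot (sign_vec f) x]%SET|%:R <= 2 ^+ n * expR (- (t ^+ 2 / 8)).
Proof.
move=> t0; set B := finset _.
(* For [x = 0] the strict inequality makes the set empty; otherwise Chernoff's bound applies. *)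
have [xE|x0] := eqVneq x 0.
  rewrite (_ : B = finset.set0) ?cards0; first by rewrite mulr_ge0 ?expR_ge0 ?exprn_ge0.
  apply/setP => f; rewrite !inE xE dotC dot0l (eqP (_ : enorm 0 == 0)) ?enorm_eq0 //.
  by rewrite mulr0 ltxx.
have X0 : 0 < enorm x by rewrite lt_def enorm_ge0 enorm_eq0 x0.
set X := enorm x in B X0 *.
(* This minimises the exponent 2 lam^2 X^2 - lam t X, with value - t^2 / 8. *)
pose lam := t / (4 * X).
have lam0 : 0 <= lam by rewrite divr_ge0 // mulr_ge0 // ltW.
have lamX : lam * X = t / 4 by rewrite /lam; field; rewrite gt_eqF.
have h : #|B|%:R * expR (t ^+ 2 / 4) <= 2 ^+ n * expR (t ^+ 2 / 8).
  have -> : t ^+ 2 / 8 = 2 * dot (lam *: x) (lam *: x).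
    rewrite dotZl dotZr -enorm_sqr -/X.
    have -> : 2 * (lam * (lam * X ^+ 2)) = 2 * (lam * X) ^+ 2 by ring.
    by rewrite lamX; field.
  apply: le_trans (sum_expR_dot_le _).
  rewrite mulr_natl -sumr_const [leRHS](bigID (mem B)) /=.
  apply: ler_wpDr; first by apply: sumr_ge0 => f _; exact: expR_ge0.
  apply: ler_sum => f; rewrite inE => /ltW fB; rewrite ler_expR dotZr.
  apply: le_trans (ler_wpM2l lam0 fB).
  by rewrite mulrCA lamX le_eqVlt; apply/orP; left; apply/eqP; field.
rewrite -(ler_pM2r (expR_gt0 (t ^+ 2 / 4))) (le_trans h) // -[leRHS]mulrA -expRD.
by rewrite le_eqVlt; apply/orP; left; apply/eqP; congr (_ * expR _); field.
Qed.

Lemma card_normr_dot_gt_le x (t : R) : 0 <= t ->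
  #|[set f | t * enorm x < `|dot (sign_vec f) x|]%SET|%:R <=
  2 * (2 ^+ n * expR (- (t ^+ 2 / 8))).
Proof.
move=> t0; have h1 := card_dot_gt_le x t0; have h2 := card_dot_gt_le (- x) t0.
rewrite [2 * _]mulr_natl mulr2n (le_trans _ (lerD h1 h2)) // -natrD ler_nat.
apply: leq_trans (leq_card_setU _ _); apply/subset_leq_card/fintype.subsetP => f.
rewrite !inE dotNr enormN; case: (ler0P (dot _ x)) => _ ->; rewrite ?orbT //.
Qed.

End SignVectors.

(** * The lower bound *)

Section Unsolvability.
Context {R : realType} {n : nat}.
Variables (L r e beta delta : R) (T : nat).
Hypotheses (n0 : (0 < n)%N) (L0 : 0 < L) (r0 : 0 < r) (e0 : 0 < e).
Hypotheses (b2 : beta < 1 / 2) (d0 : 0 <= delta).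

(** Two opposite linear functions are bounded by 3 e / 2 on the ball, so the oracle may always
    answer 0. At each point one of them is nonnegative, hence 3 e / 2 above its minimum. *)
Lemma not_solvable_large_noise : 3 / 2 * e <= delta ->
  ~ solvable (smooth_convex n L r) e beta delta T.
Proof.
move=> ed; have e0' := e0; pose i0 : 'I_n := Ordinal n0.
pose v : 'rV[R]_n := delta_mx 0 i0.
have v1 : dot v v = 1.
  rewrite /dot (bigD1 i0) //= big1 ?addr0; first by rewrite mxE !eqxx mulr1.
  by move=> j ji; rewrite mxE eqxx (negbTE ji) mulr0.
have ev : enorm v = 1 by apply/eqP; rewrite -sqrp_eq1 ?enorm_ge0 // enorm_sqr v1.
pose g := 3 / 2 * e / r.
have gr : g * r = 3 / 2 * e by rewrite divfK // gt_eqF.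
have g0 : 0 < g by rewrite divr_gt0 // mulr_gt0 // divr_gt0.
pose f (b : bool) (x : eball n r) : R := dot (((-1) ^+ b * g) *: v) (\val x).
have yr (b : bool) : eball n r (((-1) ^+ (~~ b) * r) *: v).
  rewrite /eball /= enorm_le ?(ltW r0) // dotZl dotZr v1 mulr1 mulrACA -expr2.
  by rewrite sqrr_sign mul1r -expr2.
pose y (b : bool) : eball n r := SigSub (mem_set (yr b)).
apply: (@not_solvable_of_family R _ bool _ e beta delta 0 1 T f (fun=> 0) y) => //.
- by rewrite card_bool.
- move=> b; apply: (@smooth_convex_of_subgradient R n L r _ (fun=> ((-1) ^+ b * g) *: v)).
  + exact: ltW.
  + by move=> x z; rewrite -dotDr subrKC.
  + move=> x z; rewrite subrr (eqP (_ : enorm 0 == 0)) ?enorm_eq0 //.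
    by rewrite mulr_ge0 ?enorm_ge0 // ltW.
- move=> x; rewrite [X in X%:R](_ : _ = 0%N) //.
  apply: eq_card0 => b; rewrite !inE subr0; apply/negbTE; rewrite negbK.
  rewrite (le_trans _ ed) // -gr (le_trans (normr_dot_le _ _)) //.
  have -> : enorm (((-1) ^+ b * g) *: v) = g.
    apply/eqP; rewrite -(@eqrXn2 _ 2) // ?enorm_ge0 ?(ltW g0) //.
    by rewrite enorm_sqr dotZl dotZr v1 mulr1 -expr2 exprMn sqrr_sign mul1r.
  rewrite ler_wpM2l ?(ltW g0) //; exact: (set_mem (valP x)).
- move=> x; have fy b : f b (y b) = - (3 / 2 * e).
    rewrite /f /= dotZl dotZr v1 mulr1 -gr; case: b; rewrite /= ?expr0 ?expr1; ring.
  have fx : f true x = - f false x.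
    by rewrite /f !dotZl expr1 expr0 mul1r mulN1r mulNr.
  have [xp|xn] := leP 0 (f false x).
    rewrite -[leRHS]/(1%:R) ler_nat -(card1 true); apply/subset_leq_card/fintype.subsetP.
    by case; rewrite // !inE fy opprK; lra.
  rewrite -[leRHS]/(1%:R) ler_nat -(card1 false); apply/subset_leq_card/fintype.subsetP.
  by case; rewrite // !inE fy fx opprK; lra.
- by rewrite card_bool mulr0 add0r mul1r.
Qed.

(** The same tail bound controls both exceptional sets: the directions that a query can detect, and
    those for which a given point is near-optimal. *)
Lemma not_solvable_small_noise (s G : R) : 0 < G -> 0 <= s -> s <= 1 / 6 ->
  G * s * r <= e -> G ^+ 2 <= L * e -> 9 * e <= L * r ^+ 2 ->
  hard_error e s G (3 * e / r) (2 * L)^-1 <= delta ->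
  (T%:R + 1) * expR (- (s ^+ 2 * n%:R / 8)) * 4 <= 1 ->
  ~ solvable (smooth_convex n L r) e beta delta T.
Proof.
move=> G0 s0 s6 Gs G2 eLr ed Tp; have e0' := e0.
have [F [F0 HF]] : exists (F : 'rV[R]_n -> 'rV[R]_n -> R) (F0 : 'rV[R]_n -> R),
  forall u, dot u u = 1 ->
  [/\ smooth_convex n L r (fun x : eball n r => F u (\val x)),
      forall x, enorm x <= r -> `|dot u x| <= s * enorm x ->
        `|F u x - F0 x| <= delta /\ - e <= F u x &
      F u (r *: u) <= - (3 * e)].
  have [||F [F0 HF]] := @hard_family_exists R n L r e s G L0 r0 e0 G0 s0 s6 Gs G2 eLr
      (3 * e / r) (4 * e) (2 * L)^-1 _ erefl.
  - by rewrite divfK // gt_eqF.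
  - by rewrite mulVf // gt_eqF // mulr_gt0.
  exists F, F0 => u /HF[? h ?]; split => // x xr ux.
  by have [h1 h2] := h x xr ux; split => //; exact: le_trans h1 ed.
pose q := Num.sqrt (n%:R : R).
have q0 : 0 < q by rewrite sqrtr_gt0 ltr0n.
have q2 : q ^+ 2 = n%:R by rewrite sqr_sqrtr.
pose u (f : {ffun 'I_n -> bool}) : 'rV[R]_n := q^-1 *: sign_vec f.
have u1 f : dot (u f) (u f) = 1.
  by rewrite dotZl dotZr dot_sign_vec -q2; field; rewrite gt_eqF.
have yr f : eball n r (r *: u f).
  by rewrite /eball /= enorm_le ?(ltW r0) // dotZl dotZr u1 mulr1.
pose p : R := 2 * (2 ^+ n * expR (- (s ^+ 2 * n%:R / 8))).
have card_p (x : 'rV[R]_n) :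
    #|[set f | s * enorm x < `|dot (u f) x|]%SET|%:R <= p.
  have sq0 : 0 <= s * q by rewrite mulr_ge0 // ltW.
  have := card_normr_dot_gt_le x sq0; rewrite exprMn q2; apply: le_trans.
  rewrite ler_nat; apply/subset_leq_card/fintype.subsetP => f; rewrite !inE.
  by rewrite dotZl normrM ger0_norm ?invr_ge0 ?(ltW q0) // ltr_pdivlMl // mulrA (mulrC q).
apply: (@not_solvable_of_family R _ _ _ e beta delta p p T
  (fun f x => F (u f) (\val x)) (fun x => F0 (\val x))
  (fun f => SigSub (mem_set (yr f)))) => //.
- by rewrite card_ffun card_bool card_ord expn_gt0.
- by move=> f; have [] := HF _ (u1 f).
- move=> x; apply: le_trans (card_p (\val x)).
  rewrite ler_nat; apply/subset_leq_card/fintype.subsetP => f; rewrite !inE.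
  apply: contraR; rewrite -leNgt => ux; have [_ h _] := HF _ (u1 f).
  by have [] := h _ (set_mem (valP x)) ux.
(* Outside the exceptional set, F_u(x) >= - e is at least 2 e above F_u (r u). *)
- move=> x; apply: le_trans (card_p (\val x)).
  rewrite ler_nat; apply/subset_leq_card/fintype.subsetP => f; rewrite !inE.
  apply: contraTT; rewrite -leNgt -ltNge => ux; have [_ h h3] := HF _ (u1 f).
  by have [_ h2] := h _ (set_mem (valP x)) ux; rewrite /=; lra.
- rewrite card_ffun card_bool card_ord natrX.
  have -> : (T%:R * p + p) * 2 = (T%:R + 1) * expR (- (s ^+ 2 * n%:R / 8)) * 4 * 2 ^+ n.
    by rewrite /p; ring.
  by rewrite ler_piMl // exprn_ge0.
Qed.

End Unsolvability.

(* The parametrization n = w^4, e = x^2, L = y^2 makes all quantities rational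
   functions of w, x, y, r, s. *)
Lemma hard_error_le (R : realType) (w x y r s t M : R) :
  1 <= w -> 0 < x -> 0 < y -> 0 < r -> 3 * (x * w) <= y * r -> 8 <= t -> 0 <= s ->
  s ^+ 2 = t / w ^+ 4 -> x ^+ 3 / (w * y * r) <= M -> x ^+ 2 / w ^+ 4 <= M ->
  let G := (r * s / x ^+ 2 + (y * x)^-1)^-1 in
  [/\ 0 < G, G * s * r <= x ^+ 2, G ^+ 2 <= y ^+ 2 * x ^+ 2 &
      hard_error (x ^+ 2) s G (3 * x ^+ 2 / r) (2 * y ^+ 2)^-1 <= 40 * t * M].
Proof.
move=> w1 x0 y0 r0 xw t8 s0 sE M1 M2 G.
have w0 : 0 < w by rewrite (lt_le_trans ltr01).
have x20 : 0 < x ^+ 2 by rewrite exprn_gt0.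
have yx0 : 0 < y * x by rewrite mulr_gt0.
have H0 : 0 <= r * s / x ^+ 2 by rewrite divr_ge0 ?mulr_ge0 // ltW.
have V0 : 0 < (y * x)^-1 by rewrite invr_gt0.
have Gi0 : 0 < r * s / x ^+ 2 + (y * x)^-1 by rewrite ltr_wpDl.
have G0 : 0 < G by rewrite invr_gt0.
(* Each summand of 1 / G serves one constraint: the first gives this bound, the second
   [G <= y * x]. *)
have Gsr : G * s * r <= x ^+ 2.
  have -> : G * s * r = (r * s) / (r * s / x ^+ 2 + (y * x)^-1) by rewrite /G; ring.
  rewrite ler_pdivrMr // mulrDr mulrCA divff ?gt_eqF // mulr1 lerDl.
  by rewrite mulr_ge0 // ltW.
have Gyx : G <= y * x.
  by rewrite -[leRHS]invrK lef_pV2 ?posrE // lerDr.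
split => //.
  by rewrite -exprMn ler_sqr ?nnegrE ?(ltW G0) ?(ltW yx0).
have GV : G^-1 = r * s / x ^+ 2 + (y * x)^-1 by rewrite invrK.
rewrite /hard_error GV.
have w4 : 0 < w ^+ 4 by rewrite exprn_gt0.
have t0 : 0 <= t by lra.
(* [D / w] is the first entry of the maximum in the final bound. *)
pose D := x ^+ 3 / (y * r).
have D0 : 0 < D by rewrite divr_gt0 ?exprn_gt0 ?mulr_gt0.
have DM : D <= M * w.
  have -> : D = x ^+ 3 / (w * y * r) * w by rewrite /D; field; rewrite !gt_eqF.
  by rewrite ler_wpM2r // ltW.
have Dw : D / w <= M by rewrite ler_pdivrMr.
have DwM : D / w ^+ 2 <= M.
  rewrite ler_pdivrMr ?exprn_gt0 // expr2 mulrA (le_trans DM) // ler_peMr //.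
  by apply: le_trans (_ : 0 <= D) DM; rewrite ltW.
have sw : s <= t / w ^+ 2.
  rewrite -ler_sqr ?nnegrE // ?divr_ge0 ?exprn_ge0 ?(ltW w0) // sE.
  have -> : (t / w ^+ 2) ^+ 2 = t * t / w ^+ 4 by field; rewrite gt_eqF.
  by rewrite ler_wpM2r ?invr_ge0 ?(ltW w4) // ler_peMl //; lra.
have E1 : x ^+ 2 * s ^+ 2 <= t * M.
  by rewrite sE mulrCA ler_wpM2l.
have E2 : D * s <= t * M.
  apply: (le_trans (ler_wpM2l (ltW D0) sw)).
  by rewrite mulrCA ler_wpM2l.
have E3 : x ^+ 4 / (y * r) ^+ 2 <= M.
  have -> : x ^+ 4 / (y * r) ^+ 2 = D * (x / (y * r)) by rewrite /D; field; rewrite !gt_eqF.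
  apply: le_trans Dw; rewrite ler_wpM2l ?(ltW D0) //.
  rewrite ler_pdivrMr ?mulr_gt0 // mulrC ler_pdivlMr //.
  by apply: le_trans xw; rewrite ler_peMl ?mulr_ge0 ?ltW //; lra.
have M0 : 0 <= M by apply: le_trans Dw; rewrite divr_ge0 // ltW.
have -> : 3 * x ^+ 2 / r * s * (6 * x ^+ 2 * (r * s / x ^+ 2 + (y * x)^-1)) =
    18 * (x ^+ 2 * s ^+ 2) + 18 * (D * s) by rewrite /D; field; rewrite !gt_eqF.
have -> : (2 * y ^+ 2)^-1 * (3 * x ^+ 2 / r) ^+ 2 = 9 / 2 * (x ^+ 4 / (y * r) ^+ 2).
  by field; rewrite !gt_eqF.
have -> : 2 * (2 * y ^+ 2)^-1 * (3 * x ^+ 2 / r) * G * s =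
    3 * s * (x ^+ 2 / (y ^+ 2 * r)) * G by field; rewrite !gt_eqF.
have E4 : 3 * s * (x ^+ 2 / (y ^+ 2 * r)) * G <= 3 * (D * s).
  have -> : 3 * (D * s) = 3 * s * (x ^+ 2 / (y ^+ 2 * r)) * (y * x).
    by rewrite /D; field; rewrite !gt_eqF.
  rewrite ler_wpM2l // !mulr_ge0 ?invr_ge0 ?mulr_ge0 ?exprn_ge0 //; exact: ltW.
(* In units of [t * M] the terms sum to at most 18 + 18 + 3 + 9 / 16 < 40. *)
have : 8 * M <= t * M by rewrite ler_wpM2r.
lra.
Qed.

Lemma ln16_ge1 (R : realType) : 1 <= ln (16 : R).
Proof.
have h : expR (1 / 2) <= 2 :> R.
  have := expR_ge1Dx (- (1 / 2) : R); rewrite expRN => h.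
  have : 2^-1 <= (expR (1 / 2 : R))^-1 by apply: le_trans h; lra.
  by rewrite lef_pV2 ?posrE ?expR_gt0.
have h2 : expR 1 <= 16 :> R.
  have -> : (1 : R) = 1 / 2 + 1 / 2 by lra.
  by rewrite expRD; have := expR_gt0 (1 / 2 : R); nra.
by rewrite -ler_expR lnK // posrE.
Qed.

(** The non-asymptotic form with explicit constants: each [delta] above the bound is refuted by one
    of the two unsolvability lemmas. *)
Lemma max_noise_smooth_convex_le (R : realType) (c beta L r e : R) (n T : nat) :
  let Q := n%:R `^ (3 / 4) * r * Num.sqrt L / Num.sqrt e in
  1 <= c -> beta < 1 / 2 -> (0 < n)%N -> 0 < L -> 0 < r ->
  0 < e < 1 / 9 * (L * r ^+ 2 / Num.sqrt n%:R) ->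
  T%:R <= Q `^ c ->
  (max_noise (smooth_convex n L r) e beta T <=
   (Num.max (e `^ (3 / 2) / (n%:R `^ (1 / 4) * Num.sqrt L * r)) (e / n%:R)
     * (13 * 16 * c * ln (16 * Q)) ^+ 2)%:E)%E.
Proof.
move=> Q c1 b2 n0 L0 r0 /andP[e0 eL] TQ.
pose w : R := n%:R `^ (1 / 4); pose x := Num.sqrt e; pose y := Num.sqrt L.
have nR0 : 0 < n%:R :> R by rewrite ltr0n.
have w0 : 0 < w by rewrite powR_gt0.
have x0 : 0 < x by rewrite sqrtr_gt0.
have y0 : 0 < y by rewrite sqrtr_gt0.
have xe : x ^+ 2 = e by rewrite sqr_sqrtr // ltW.
have yL : y ^+ 2 = L by rewrite sqr_sqrtr // ltW.
have wX k : w ^+ k = n%:R `^ (k%:R / 4).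
  by rewrite -powR_mulrn ?(ltW w0) // /w -powRrM; congr (_ `^ _); field.
have w4 : w ^+ 4 = n%:R by rewrite wX divff ?powRr1 // ltW.
have w2 : w ^+ 2 = Num.sqrt n%:R.
  by rewrite wX -powR12_sqrt ?(ltW nR0) //; congr (_ `^ _); field.
have w3 : n%:R `^ (3 / 4) = w ^+ 3 by rewrite wX.
have w1 : 1 <= w.
  by rewrite -(@ler_pXn2r _ 4) ?nnegrE ?(ltW w0) // expr1n w4 ler1n.
have x3 : e `^ (3 / 2) = x ^+ 3.
  rewrite /x -powR12_sqrt ?(ltW e0) // -powR_mulrn ?powR_ge0 // -powRrM.
  by congr (_ `^ _); field.
have xw : 3 * (x * w) <= y * r.
  have yr0 : 0 <= y * r by rewrite mulr_ge0 // ltW.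
  rewrite -ler_sqr ?nnegrE // ?mulr_ge0 ?(ltW x0) ?(ltW w0) //.
  have w20 : 0 < w ^+ 2 by rewrite exprn_gt0.
  move: eL; rewrite -w2 -xe -yL -(ltr_pM2r w20).
  have -> : 1 / 9 * (y ^+ 2 * r ^+ 2 / w ^+ 2) * w ^+ 2 = 1 / 9 * (y ^+ 2 * r ^+ 2).
    by field; rewrite gt_eqF.
  by rewrite !exprMn; lra.
have QE : Q = w ^+ 3 * r * y / x by rewrite /Q w3.
have Q1 : 1 <= Q.
  rewrite QE ler_pdivlMr // mul1r.
  have : x * 1 <= x * w ^+ 4 by rewrite ler_wpM2l ?(ltW x0) // exprn_ege1.
  have : w ^+ 3 * (3 * (x * w)) <= w ^+ 3 * (y * r).
    by rewrite ler_wpM2l // exprn_ge0 // ltW.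
  have : 0 < x * w ^+ 4 by rewrite mulr_gt0 // exprn_gt0.
  by lra.
clearbody Q; rewrite x3 -/w -/y -w4 -[X in X / w ^+ 4]xe; set M := Num.max _ _.
have M1 : x ^+ 3 / (w * y * r) <= M by rewrite le_max lexx.
have M2 : x ^+ 2 / w ^+ 4 <= M by rewrite le_max lexx orbT.
have M0 : 0 < M.
  by apply: lt_le_trans M2; rewrite divr_gt0 ?exprn_gt0.
set l := ln (16 * Q).
have l1 : 1 <= l.
  have Q0 : 0 < Q by rewrite (lt_le_trans ltr01).
  apply: (le_trans (ln16_ge1 R)); rewrite /l ler_ln ?posrE ?mulr_gt0 //.
  by rewrite ler_peMr.
have cl1 : 1 <= c * l by rewrite mulr_ege1.
apply: ge_ereal_sup => _ [delta [d0 sol] <-]; rewrite lee_fin leNgt.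
apply/negP => dM; move: sol.
set t := 8 * (c * l).
have t8 : 8 <= t by rewrite /t; lra.
(* As t = 8 c l, the factor 13 * 16 * c * l equals 26 t, and 26^2 = 676. *)
have dt : 676 * t * t * M <= delta.
  apply: (le_trans _ (ltW dM)).
  by rewrite le_eqVlt; apply/orP; left; apply/eqP; rewrite /t; ring.
have tM : 0 <= t * M by rewrite mulr_ge0 ?(ltW M0) //; lra.
have tt : 8 * (t * M) <= t * (t * M) by rewrite ler_wpM2r.
(* This is the case s > 1 / 6, where e <= M n already bounds 3 e / 2 by 54 t M. *)
have [nt|nt] := ltP n%:R (36 * t).
  apply: not_solvable_large_noise => //.
  apply: le_trans dt.
  have eM : e <= M * n%:R by rewrite -ler_pdivrMr // -w4 -xe.
  have : M * n%:R <= M * (36 * t) by rewrite ler_wpM2l // ltW.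
  by lra.
pose s := Num.sqrt (t / w ^+ 4).
have tw0 : 0 <= t / w ^+ 4 by rewrite divr_ge0 ?exprn_ge0 ?(ltW w0) //; lra.
have sE : s ^+ 2 = t / w ^+ 4 by rewrite sqr_sqrtr.
have s0 : 0 <= s by exact: sqrtr_ge0.
have s6 : s <= 1 / 6.
  rewrite -ler_sqr ?nnegrE // sE w4 ler_pdivrMr //; lra.
have [G0 Gs G2 Ge] := hard_error_le w1 x0 y0 r0 xw t8 s0 sE M1 M2.
rewrite xe yL in G0 Gs G2 Ge.
apply: (not_solvable_small_noise n0 L0 r0 e0 b2 d0 G0 s0 s6 Gs G2).
- have wle : x ^+ 2 * 1 <= x ^+ 2 * w ^+ 2.
    by rewrite ler_wpM2l ?exprn_ge0 ?exprn_ege1 // ltW.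
  have : (3 * (x * w)) ^+ 2 <= (y * r) ^+ 2.
    by rewrite ler_sqr ?nnegrE // !mulr_ge0 // ltW.
  by rewrite -xe -yL !exprMn; lra.
- by apply: (le_trans Ge); apply: le_trans dt; lra.
have -> : s ^+ 2 * n%:R / 8 = c * l.
  by rewrite sE w4 /t; field; rewrite gt_eqF.
(* The last condition holds since 4 (T + 1) <= 8 Q^c, while exp (c l) = (16 Q)^c >= 16 Q^c. *)
have Qc1 : 1 <= Q `^ c.
  by rewrite -(powRr0 Q) ler_powR // (le_trans ler01).
have E1 : expR (c * l) = 16 `^ c * Q `^ c.
  rewrite -powRM ?(le_trans ler01 Q1) // /powR gt_eqF //.
  by rewrite mulr_gt0 // (lt_le_trans ltr01).
have E2 : 16 <= 16 `^ c :> R.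
  by rewrite -[leLHS]powRr1 // ler_powR // ler1n.
rewrite expRN mulrAC -[leRHS]mul1r ler_pdivrMr ?expR_gt0 // E1 mul1r.
have : 16 * Q `^ c <= 16 `^ c * Q `^ c by rewrite ler_wpM2r // powR_ge0.
by lra.
Qed.

Theorem mainTheorem2 (R : realType) (c : R) (hc : 1 <= c) :
  exists (C0 C1 c0 : R) (n0 : nat),
    [/\ 0 < C0, 0 < C1, 0 < c0 & (0 < n0)%N] /\
    forall beta : R, 0 < beta < 1 / 2 ->
    forall (n : nat -> nat) (L r eps : nat -> R) (T : nat -> nat),
      let Q k :=
        (n k)%:R `^ (3 / 4) * r k * Num.sqrt (L k) / Num.sqrt (eps k) in
      n k @[k --> \oo] --> \oo ->
      (forall k, (n0 <= n k)%N) ->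
      (forall k, 0 < L k /\ 0 < r k) ->
      (forall k, 0 < eps k < c0 * (L k * r k ^+ 2 / Num.sqrt (n k)%:R)) ->
      (T k)%:R / (Q k `^ c) @[k --> \oo] --> (0 : R) ->
      \forall k \near \oo,
        (max_noise (smooth_convex (n k) (L k) (r k)) (eps k) beta (T k) <=
         (C0 * Num.max
                 (eps k `^ (3 / 2) /
                    ((n k)%:R `^ (1 / 4) * Num.sqrt (L k) * r k))
                 (eps k / (n k)%:R)
             * (13 * C1 * c * ln (C1 * Q k)) ^+ 2)%:E)%E.
Proof.
(* The bound 1 / 9 ensures 3 sqrt(eps) n^(1/4) <= sqrt(L) r; the 16 inside the logarithm pays for
   the constants in the union bound. *)
exists 1, 16, (1 / 9), 1%N; split; first by split.
move=> beta /andP[_ b2] n L r eps T Q _ n1 Lr epsb TQ.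
near=> k.
have [L0 r0] := Lr k; have /andP[e0 _] := epsb k.
rewrite mul1r; apply: max_noise_smooth_convex_le => //.
have Q0 : 0 < Q k by rewrite divr_gt0 ?sqrtr_gt0 // !mulr_gt0 ?powR_gt0 ?sqrtr_gt0 ?ltr0n.
(* The little-o condition enters as T <= Q^c for late members. *)
rewrite -[leRHS]mul1r -ler_pdivrMr ?powR_gt0 //.
near: k; exact: (cvgr_le _ TQ _ ltr01).
Unshelve. all: by end_near. Qed.
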